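(* For every integer $k\ge 0$, there is a tournament $T$ of order $n=3^k$ such that $\rho(T)=\lfloor n/2\rfloor$.
   Context: All tournaments are finite. A tournament is a complete oriented graph: a digraph $T$ with vertex set $V(T)$ and arc set $A(T)$ (no loops) such that for all distinct $u,v\in V(T)$ exactly one of $uv$, $vu$ belongs to $A(T)$; its order is $|V(T)|$. $Aut(T)$ denotes the automorphism group of $T$; the identity is the trivial automorphism. A vertex labeling of $T$ with two labels is a total function $\phi:V(T)\to L$ with $|L|=2$ (not required to be surjective, so a label class may be empty). An automorphism $\sigma\in Aut(T)$ preserves $\phi$ if $\phi(\sigma(v))=\phi(v)$ for all $v\in V(T)$. The labeling $\phi$ is 2-distinguishing if no nontrivial automorphism preserves it. A distinguishing vertex class is one of the two sets of vertices having the same label under a 2-distinguishing vertex labeling. $\rho(T)$ denotes the minimum size of a distinguishing vertex class of $T$, over all 2-distinguishing vertex labelings of $T$. (It is known that every finite tournament has a 2-distinguishing vertex labeling, so $\rho(T)$ is defined.) *)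

(* Defs.v *)
From HB Require Import structures.
From mathcomp Require Import all_boot all_fingroup.
Set Implicit Arguments.
Unset Strict Implicit.
Unset Printing Implicit Defensive.

Structure tournament := Tournament {
  vertex :> finType;
  arc : rel vertex;
  arc_irr : irreflexive arc;
  arc_tot : forall u v : vertex, u != v -> arc u v (+) arc v u
}.

(* [Aut] is taken by mathcomp.fingroup.automorphism (group automorphisms). *)
Definition tAut (T : tournament) : {set {perm T}} :=
  [set s : {perm T} | [forall u : T, forall v : T, arc (s u) (s v) == arc u v]].

Definition labeling (T : tournament) : Type := {ffun T -> bool}.

Definition preserves (T : tournament) (s : {perm T}) (phi : labeling T) : bool :=
  [forall v : T, phi (s v) == phi v].

Definition distinguishing (T : tournament) (phi : labeling T) : bool :=
  [forall s in tAut T, preserves s phi ==> (s == 1%g)].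

Definition label_class (T : tournament) (phi : labeling T) (b : bool) : {set T} :=
  [set v : T | phi v == b].

Definition distinguishing_class (T : tournament) (S : {set T}) : bool :=
  [exists phi : {ffun T -> bool}, distinguishing phi &&
    [exists b : bool, S == label_class phi b]].

(* The default #|T| bounds the size of every class, so it does not affect the
   minimum as soon as one distinguishing class exists. *)
Definition rho (T : tournament) : nat :=
  \big[minn/#|T|]_(S : {set T} | distinguishing_class S) #|S|.

(* Main.v *)
Require Import Defs.
From mathcomp Require Import all_boot all_fingroup.
From mathcomp Require Import ssralg zmodp zify.
Import Defs GRing.Theory.

Set Implicit Arguments.
Unset Strict Implicit.
Unset Printing Implicit Defensive.

(** Start from the one-vertex tournament and repeatedly replace [T] by
    [triple T], the lexicographic product of the cyclic triangle with [T]: three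
    copies (blocks) of [T], with all arcs between two blocks oriented along the
    triangle.

    Call a vertex set asymmetric if only the identity automorphism stabilizes
    it; these are exactly the distinguishing classes. Writing #|T| = 2m+1, the
    induction carries more than the value of the minimum
    ([two_asymmetric_classes]): asymmetric sets have size m or m+1, both sizes
    occur, and any two asymmetric sets of the same size are exchanged by an
    automorphism.

    In [triple T], an asymmetric set S meets each block in an asymmetric set of
    T, of size m or m+1. The three sizes cannot all be equal: the three traces
    would then be equivalent, and rotating the triangle while matching them
    would be a nontrivial automorphism stabilizing S. This is where the
    uniqueness up to automorphism is used. Hence |S| is 3m+1 or 3m+2, and since
    the triangle has as many rotations as there are ways of placing the
    exceptional block, S is again determined by its size up to automorphism.

    Conversely, traces of sizes m+1, m, m give an asymmetric set of size 3m+1.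
    This needs all automorphisms of [triple T], which are the rotations of the
    triangle combined with automorphisms inside the blocks
    ([arc_preserving_wreath]): two vertices lie in the same block if and only if
    fewer than #|T| vertices see them differently, and this number is an
    automorphism invariant. *)

(** * Automorphisms and asymmetric sets *)

Section Embeddings.

Variable T : tournament.
Implicit Types (f : T -> T) (S : {set T}).

(** In a finite tournament such a map is automatically bijective, so plain
    functions stand for automorphisms and no inverse has to be supplied. *)
Definition arc_preserving f := forall u v, arc (f u) (f v) = arc u v.

Definition carries f (S S' : {set T}) := forall u, (f u \in S') = (u \in S).

Definition asymmetric_set S :=
  forall f, arc_preserving f -> carries f S S -> f =1 id.

Lemma arc_preserving_inj f : arc_preserving f -> injective f.
Proof.
move=> fA u v fuv; apply/eqP/negPn/negP=> /arc_tot.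
by rewrite -fA -(fA v u) fuv arc_irr.
Qed.

Lemma carries_card f S S' : arc_preserving f -> carries f S S' -> #|S'| = #|S|.
Proof.
move=> /arc_preserving_inj f_inj fS; have -> : S = f @^-1: S'.
  by apply/setP=> u; rewrite inE fS.
by rewrite on_card_preimset //; apply/onW_bij/injF_bij.
Qed.

Lemma asymmetric_setC S : asymmetric_set S -> asymmetric_set (~: S).
Proof.
move=> aS f fA fS; apply: aS => // u.
by have := fS u; rewrite !inE => /negb_inj.
Qed.

(** A labeling with class [S] is preserved exactly by the automorphisms that
    stabilize [S]. *)
Lemma distinguishing_classP S :
  reflect (asymmetric_set S) (distinguishing_class S).
Proof.
apply: (iffP existsP) => [[phi /andP[/forall_inP dphi]]|aS].
  move=> /existsP[b /eqP ->] f fA fS.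
  have f_inj := arc_preserving_inj fA.
  have: perm f_inj == 1%g.
    apply: (implyP (dphi _ _)).
      by rewrite inE; apply/'forall_forallP=> u v; rewrite !permE fA.
    apply/forallP=> u; rewrite permE; have := fS u; rewrite !inE.
    by case: (phi (f u)); case: (phi u); case: (b).
  by move=> /eqP/permP f1 u; have := f1 u; rewrite permE perm1.
exists [ffun u => u \in S]; apply/andP; split; last first.
  by apply/existsP; exists true; apply/eqP/setP=> u; rewrite inE ffunE eqb_id.
apply/forall_inP=> s; rewrite inE => /'forall_forallP sA.
apply/implyP=> /forallP sS; apply/eqP/permP=> u; rewrite perm1; apply: aS.
  by move=> v w; apply/eqP.
by move=> v; have := sS v; rewrite !ffunE => /eqP.
Qed.

Lemma rho_eq m :
    (exists2 S, asymmetric_set S & #|S| = m) ->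
    (forall S, asymmetric_set S -> m <= #|S|) ->
  rho T = m.
Proof.
case=> S aS cS min_m; apply/eqP; rewrite eqn_leq /rho; apply/andP; split.
  (* [minn] has no neutral element, so [S] is reached by induction on the
     enumeration. *)
  rewrite -cS; have /distinguishing_classP dS := aS.
  move: (mem_index_enum S); elim: (index_enum _) => //= S' r IHr.
  rewrite inE big_cons => /predU1P[<-|/IHr {}IHr].
    by rewrite dS geq_minl.
  by case: ifP => // _; rewrite geq_min IHr orbT.
apply: (big_ind (fun n => m <= n)) => [|x y mx my|S' /distinguishing_classP].
- by rewrite -cS max_card.
- by rewrite leq_min mx.
exact: min_m.
Qed.

(** The number of these vertices is an invariant of the pair that tells whether
    two vertices of a composed tournament lie in the same block. *)
Definition separators (u v : T) := [set w | arc w u != arc w v].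

Lemma separators_card f u v :
  arc_preserving f -> #|separators (f u) (f v)| = #|separators u v|.
Proof. by move=> fA; apply: (carries_card fA) => w; rewrite !inE !fA. Qed.

(** Of two distinct vertices, the tail of the arc between them separates them
    but the head does not. *)
Lemma separators_lt (u v : T) : #|separators u v| < #|T|.
Proof.
rewrite -cardsT; apply: proper_card; rewrite properT.
apply/negP=> /eqP sepT.
have [] : u \in separators u v /\ v \in separators u v by rewrite sepT !inE.
rewrite !inE !arc_irr; have [->|/arc_tot] := eqVneq u v.
  by rewrite arc_irr.
by case: (arc u v); case: (arc v u).
Qed.

End Embeddings.

(** * The cyclic group of order three *)

Lemma Z3_ind (P : 'Z_3 -> Prop) :
  P 0%R -> P 1%R -> P (1 + 1)%R -> forall i, P i.
Proof.
move=> P0 P1 P2 [[|[|[|n]]] lt_n3] //.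
- by rewrite (_ : Ordinal _ = 0%R) //; apply/val_inj.
- by rewrite (_ : Ordinal _ = 1%R) //; apply/val_inj.
by rewrite (_ : Ordinal _ = (1 + 1)%R) //; apply/val_inj.
Qed.

Lemma Z3_sum (F : 'Z_3 -> nat) :
  \sum_i F i = F 0%R + F 1%R + F (1 + 1)%R.
Proof.
rewrite !big_ord_recl big_ord0 addn0 addnA.
by congr (_ + F _ + F _); apply/val_inj.
Qed.

(** Both functions take two adjacent values, so the common sum fixes how often
    each value is taken; two words of length three over two letters with the
    same letter counts are rotations of each other. This fails for longer words,
    and it is why three blocks, rather than five or seven, are used. *)
Lemma Z3_two_values_rotate (m : nat) (a b : 'Z_3 -> nat) :
    (forall i, a i = m \/ a i = m.+1) -> (forall i, b i = m \/ b i = m.+1) ->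
    \sum_i a i = \sum_i b i ->
  exists r, forall i, b (i + r)%R = a i.
Proof.
rewrite !Z3_sum => am bm sum_ab.
suff [r [r0 [r1 r2]]] : exists r, b (0 + r)%R = a 0%R /\
    b (1 + r)%R = a 1%R /\ b (1 + 1 + r)%R = a (1 + 1)%R.
  by exists r; elim/Z3_ind.
have e3 : (1 + 1 + 1 = 0 :> 'Z_3)%R by apply/val_inj.
have rot (P : 'Z_3 -> Prop) : P 0%R \/ P 1%R \/ P (1 + 1)%R -> exists r, P r.
  by case=> [|[]]; eexists; eassumption.
apply: rot; rewrite !addr0 !add0r !addrA e3 add0r.
move: (am 0%R) (am 1%R) (am (1 + 1)%R) (bm 0%R) (bm 1%R) (bm (1 + 1)%R) sum_ab.
move: (a 0%R) (a 1%R) (a (1 + 1)%R) (b 0%R) (b 1%R) (b (1 + 1)%R).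
move=> a0 a1 a2 b0 b1 b2; lia.
Qed.

(** * Three copies of a tournament on a cyclic triangle *)

Section TripleTournament.

Variable T : tournament.

Definition triple_arc (p q : 'Z_3 * T) :=
  if p.1 == q.1 then arc p.2 q.2 else q.1 == (p.1 + 1)%R.

Lemma triple_arc_irr : irreflexive triple_arc.
Proof. by move=> p; rewrite /triple_arc eqxx arc_irr. Qed.

Lemma triple_arc_tot p q : p != q -> triple_arc p q (+) triple_arc q p.
Proof.
case: p q => [i x] [j y]; rewrite /triple_arc /= xpair_eqE.
have [_ /= /arc_tot //|ij _] := eqVneq i j.
by move: ij; elim/Z3_ind: i; elim/Z3_ind: j.
Qed.

Definition triple := Tournament triple_arc_irr triple_arc_tot.

Lemma triple_card : #|triple| = 3 * #|T|.
Proof. by rewrite card_prod card_ord. Qed.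

Definition block (S : {set triple}) (i : 'Z_3) : {set T} :=
  [set x | (i, x) \in S].

Lemma block_card (S : {set triple}) : #|S| = \sum_i #|block S i|.
Proof.
rewrite -sum1_card (eq_bigr (fun i => \sum_(x in block S i) 1)); last first.
  by move=> i _; rewrite sum1_card.
by rewrite pair_big_dep /=; apply: eq_bigl => -[i x]; rewrite inE.
Qed.

(** The elements of the wreath product of Aut(T) by the group of rotations of
    the triangle. *)
Definition wreath (r : 'Z_3) (g : 'Z_3 -> T -> T) (p : triple) : triple :=
  ((p.1 + r)%R, g p.1 p.2).

Lemma wreath_arc_preserving r g :
  (forall i, arc_preserving (g i)) -> arc_preserving (wreath r g).
Proof.
move=> gA [i x] [j y]; rewrite /wreath /arc /= /triple_arc /=.
rewrite (inj_eq (addIr r)) addrAC (inj_eq (addIr r)).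
by case: eqP => // ->; rewrite gA.
Qed.

Lemma wreath_carries r g S S' :
    (forall i, carries (g i) (block S i) (block S' (i + r)%R)) ->
  carries (wreath r g) S S'.
Proof. by move=> gS [i x]; have := gS i x; rewrite !inE. Qed.

(** Vertices outside a block do not separate its vertices, so the bound is the
    one for [T]. *)
Lemma separators_same_block i (x y : T) :
  #|separators ((i, x) : triple) (i, y)| < #|T|.
Proof.
apply: leq_ltn_trans (separators_lt x y).
have i_inj: injective (fun z : T => (i, z) : triple) by move=> ? ? [].
rewrite -(card_imset _ i_inj); apply: subset_leq_card.
apply/subsetP=> -[j z]; rewrite inE /arc /= /triple_arc /=.
have [->|] := eqVneq j i; last by rewrite eqxx.
by move=> sep_z; apply: imset_f; rewrite inE.
Qed.

(** Every vertex of the third block separates two vertices taken from the other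
    two: the triangle is cyclic. *)
Lemma separators_other_block i j (x y : T) :
  i != j -> #|T| <= #|separators ((i, x) : triple) (j, y)|.
Proof.
move=> ij.
(* The elements of Z/3 sum to 0, which names the third block. *)
pose k := (- (i + j))%R.
have k_inj: injective (fun z : T => (k, z) : triple) by move=> ? ? [].
rewrite -cardsT -(card_imset _ k_inj); apply: subset_leq_card.
apply/subsetP=> _ /imsetP[z _ ->]; rewrite inE /arc /= /triple_arc /= /k.
by move: ij; elim/Z3_ind: i {k k_inj}; elim/Z3_ind: j.
Qed.

Lemma same_blockE (p q : triple) :
  (p.1 == q.1) = (#|separators p q| < #|T|).
Proof.
case: p q => [i x] [j y] /=; have [->|ij] := eqVneq i j.
  by rewrite separators_same_block.
by rewrite ltnNge separators_other_block.
Qed.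

(** Being in the same block is an invariant, so an automorphism permutes the
    blocks; it then preserves the orientation of the triangle, hence rotates
    it. *)
Lemma arc_preserving_wreath (f : triple -> triple) :
    0 < #|T| -> arc_preserving f ->
  exists r, exists2 g, forall i, arc_preserving (g i) & f =1 wreath r g.
Proof.
move=> /card_gt0P[x0 _] fA; pose b i := (f (i, x0)).1.
have f_block p q : ((f p).1 == (f q).1) = (p.1 == q.1).
  by rewrite !same_blockE separators_card.
have f1 i x : (f (i, x)).1 = b i by apply/eqP; rewrite f_block.
have bS i : b (i + 1)%R = (b i + 1)%R.
  have ne_i : (i == i + 1)%R = false by elim/Z3_ind: i.
  have := fA (i, x0) ((i + 1)%R, x0); rewrite /arc /= /triple_arc /=.
  by rewrite f_block /= ne_i eqxx => /eqP.
have b1 : b 1%R = (1 + b 0)%R by rewrite addrC -bS add0r.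
have bE i : b i = (i + b 0)%R.
  by elim/Z3_ind: i => //; [rewrite add0r | rewrite bS b1 addrAC].
exists (b 0%R), (fun i x => (f (i, x)).2) => [i x y|[i x]].
  have := fA (i, x) (i, y); rewrite /arc /= /triple_arc /=.
  by rewrite f_block /= eqxx.
by rewrite /wreath /= -bE -(f1 i x); case: (f _).
Qed.

(** An automorphism of one block extends by the identity on the other two. *)
Lemma asymmetric_block (S : {set triple}) i :
  asymmetric_set S -> asymmetric_set (block S i).
Proof.
move=> aS f fA fS x; pose g j := if j == i then f else id.
have gA j : arc_preserving (g j) by rewrite /g; case: eqP.
have gS : carries (wreath 0%R g) S S.
  by apply: wreath_carries => j; rewrite addr0 /g; case: eqP => // ->.
have := aS _ (wreath_arc_preserving 0%R gA) gS (i, x).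
by rewrite /wreath /g /= eqxx => -[].
Qed.

(** Matchings of the traces along the triangle would assemble into an
    automorphism that stabilizes [S] and moves every block. *)
Lemma asymmetric_blocks_inequivalent (S : {set triple}) (g : 'Z_3 -> T -> T) :
    0 < #|T| -> asymmetric_set S -> (forall i, arc_preserving (g i)) ->
  ~ forall i, carries (g i) (block S i) (block S (i + 1)%R).
Proof.
move=> /card_gt0P[x _] aS gA /wreath_carries gS.
by have := aS _ (wreath_arc_preserving 1%R gA) gS (0%R, x); case.
Qed.

End TripleTournament.

Arguments asymmetric_block {T S} i _ : rename.

(** * The inductive invariant *)

(** Up to automorphism there are exactly two asymmetric sets, one of size [m]
    and its complement of size [m.+1]. *)
Definition two_asymmetric_classes (T : tournament) (m : nat) :=
  [/\ #|T| = m.*2.+1,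
      exists2 S : {set T}, asymmetric_set S & #|S| = m,
      forall S : {set T}, asymmetric_set S -> #|S| = m \/ #|S| = m.+1
    & forall S S' : {set T}, asymmetric_set S -> asymmetric_set S' ->
        #|S| = #|S'| -> exists f, arc_preserving f /\ carries f S S'].

Section Step.

Variables (T : tournament) (m : nat).
Hypothesis Tm : two_asymmetric_classes T m.

Let T_gt0 : 0 < #|T|. Proof. by case: Tm => ->. Qed.

Lemma triple_asymmetric_exists :
  exists2 S : {set triple T}, asymmetric_set S & #|S| = (3 * m).+1.
Proof.
have [cT [S aS cS] _ _] := Tm.
(* Traces of sizes m+1, m, m: the larger one pins block 0, hence the
   rotation. *)
pose B i := if (i == 0 :> 'Z_3)%R then ~: S else S.
pose S3 : {set triple T} := [set p | p.2 \in B p.1].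
have blockS3 i : block S3 i = B i by apply/setP=> x; rewrite !inE.
have cardB i : #|B i| = if (i == 0)%R then m.+1 else m.
  by rewrite /B; case: eqP => // _; rewrite cardsCs setCK cS cT; lia.
have aB i : asymmetric_set (B i).
  by rewrite /B; case: eqP => // _; apply: asymmetric_setC.
exists S3; last by rewrite block_card Z3_sum !blockS3 !cardB /=; lia.
move=> f fA fS; have [r [g gA fE]] := arc_preserving_wreath T_gt0 fA.
have gS i : carries (g i) (B i) (B (i + r)%R).
  by move=> x; have := fS (i, x); rewrite fE !inE.
have r0 : (r = 0)%R.
  have := carries_card (gA 0%R) (gS 0%R); rewrite !cardB add0r eqxx.
  by case: eqP => // _; lia.
move=> [i x]; rewrite fE /wreath /= (aB i) ?r0 ?addr0 //.
by move: (gS i); rewrite r0 addr0.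
Qed.

Lemma triple_asymmetric_card (S : {set triple T}) :
  asymmetric_set S -> #|S| = (3 * m).+1 \/ #|S| = (3 * m).+2.
Proof.
move=> aS; have [_ _ card_asym equiv_asym] := Tm.
have card_block i := card_asym _ (asymmetric_block i aS).
have not_const : ~ forall i, #|block S i| = #|block S (i + 1)%R|.
  move=> eqS; have /fin_all_exists[g gP] i :=
    equiv_asym _ _ (asymmetric_block i aS) (asymmetric_block _ aS) (eqS i).
  by apply: (asymmetric_blocks_inequivalent T_gt0 aS (g := g)) => i;
    case: (gP i).
have e3 : (1 + 1 + 1 = 0 :> 'Z_3)%R by apply/val_inj.
rewrite block_card Z3_sum.
have: ~ (#|block S 0%R| = #|block S 1%R| /\
         #|block S 1%R| = #|block S (1 + 1)%R|).
  case=> e01 e12; apply: not_const; elim/Z3_ind; rewrite ?e3 ?add0r //.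
  by rewrite e01.
move: (card_block 0%R) (card_block 1%R) (card_block (1 + 1)%R); lia.
Qed.

(** Rotate the triangle so that the block sizes agree, then match the traces
    block by block. *)
Lemma triple_asymmetric_equiv (S S' : {set triple T}) :
    asymmetric_set S -> asymmetric_set S' -> #|S| = #|S'| ->
  exists f, arc_preserving f /\ carries f S S'.
Proof.
move=> aS aS'; have [_ _ card_asym equiv_asym] := Tm.
rewrite !block_card => eqSS'.
have [r rP] := Z3_two_values_rotate
  (fun i => card_asym _ (asymmetric_block i aS))
  (fun i => card_asym _ (asymmetric_block i aS')) eqSS'.
have /fin_all_exists[g gP] i := equiv_asym _ _ (asymmetric_block i aS)
  (asymmetric_block (i + r)%R aS') (esym (rP i)).
exists (wreath r g); split.
  by apply: wreath_arc_preserving => i; case: (gP i).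
by apply: wreath_carries => i; case: (gP i).
Qed.

Lemma triple_two_asymmetric_classes :
  two_asymmetric_classes (triple T) (3 * m).+1.
Proof.
split; [|exact: triple_asymmetric_exists|exact: triple_asymmetric_card|].
  by rewrite triple_card; case: Tm => -> _ _ _; lia.
exact: triple_asymmetric_equiv.
Qed.

End Step.

Definition point : tournament.
Proof.
exists unit (fun _ _ => false) => //; by case=> [[]].
Defined.

Lemma point_two_asymmetric_classes : two_asymmetric_classes point 0.
Proof.
split; first exact: card_unit.
- by exists set0; [move=> f _ _ []; case: (f _) | rewrite cards0].
- by move=> S _; have := max_card S; rewrite [#|point|]card_unit; lia.
move=> S S' _ _ eqSS'; exists id; split=> // -[].
have cardE (A : {set point}) : #|A| = (tt \in A).
  by rewrite -sum1_card big_mkcond (big_pred1 tt) //=; case: (tt \in A).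
by move: eqSS'; rewrite !cardE /=; do 2!case: (tt \in _).
Qed.

Lemma iterated_triple (k : nat) :
  exists T : tournament, #|T| = 3 ^ k /\ exists m, two_asymmetric_classes T m.
Proof.
elim: k => [|k [T [cT [m Tm]]]].
  exists point; split; first exact: card_unit.
  by exists 0; exact: point_two_asymmetric_classes.
exists (triple T); split; first by rewrite triple_card cT expnS.
by exists (3 * m).+1; apply: triple_two_asymmetric_classes.
Qed.

Theorem theorem3 (k : nat) :
  exists T : tournament, #|T| = 3 ^ k /\ rho T = #|T| %/ 2.
Proof.
have [T [cT [m [oddT exm cardm _]]]] := iterated_triple k.
exists T; split=> //; rewrite oddT.
rewrite (rho_eq exm) => [|S /cardm]; lia.
Qed.
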